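(* Let $\mathbb{F}=\mathbb{R}$ or $\mathbb{F}=\mathbb{C}$. Let $T\in S^d(\mathbb{F}^n)$ be symmetric and let $r\le n$. Consider rank-$r$ approximations of $T$ of the form $\sum_{k=1}^r\sigma_k\,v_{k1}\otimes\cdots\otimes v_{kd}$ with $\sigma_k\in\mathbb{F}$, $v_{kj}\in\mathbb{F}^n$, $\|v_{kj}\|=1$, subject to the condition $$\langle v_{kj},v_{k'j'}\rangle=0\quad\text{for all }k\ne k'\text{ and all }1\le j,j'\le d.$$ Then the optimal such approximation can be chosen symmetric: the minimum of $\big\|T-\sum_{k=1}^r\sigma_k\,v_{k1}\otimes\cdots\otimes v_{kd}\big\|$ over all approximations satisfying this condition is attained by one of the form $\sigma_1v_1^{\otimes d}+\cdots+\sigma_rv_r^{\otimes d}$, i.e. with $v_{k1}=\cdots=v_{kd}=v_k$ for every $k$.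
   Context: Tensors in $\mathbb{F}^{n\times\cdots\times n}$ ($d$ factors) carry the inner product $\langle T,S\rangle=\sum_{i_1,\dots,i_d}T(i_1,\dots,i_d)\overline{S(i_1,\dots,i_d)}$ and norm $\|T\|=\sqrt{\langle T,T\rangle}$. The tensor $v_1\otimes\cdots\otimes v_d$ has entries $\prod_j v_j(i_j)$, and $v^{\otimes d}$ is the $d$-fold tensor power. $S^d(\mathbb{F}^n)$ denotes the tensors in $\mathbb{F}^{n\times\cdots\times n}$ invariant under all permutations of the $d$ indices. *)

(* Defs.v *)
From HB Require Import structures.
From mathcomp Require Import all_boot all_order all_algebra all_fingroup.
From mathcomp Require Import reals.
From mathcomp Require Import complex.
Set Implicit Arguments.
Unset Strict Implicit.
Unset Printing Implicit Defensive.
Import Order.TTheory GRing.Theory Num.Theory.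
Local Open Scope ring_scope.

Inductive scalar_kind := RealScalars | ComplexScalars.

Definition base_field (R : realType) (K : scalar_kind) : numFieldType :=
  match K with
  | RealScalars => R
  | ComplexScalars => complex R
  end.

Definition sconj (R : realType) (K : scalar_kind) : base_field R K -> base_field R K :=
  match K return base_field R K -> base_field R K with
  | RealScalars => fun x => x
  | ComplexScalars => fun z : complex R => conjc z
  end.

Definition sre (R : realType) (K : scalar_kind) : base_field R K -> R :=
  match K return base_field R K -> R with
  | RealScalars => fun x => x
  | ComplexScalars => fun z : complex R => complex.Re z
  end.

(* Vectors of F^n are the arrays indexed by 'I_n and tensors of order d the
   arrays indexed by multi-indices, so both share one inner product and norm.
   The codomain is F^o only to give arrays their F-module structure. *)
Notation array R K I := {ffun I -> (base_field R K)^o} (only parsing).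
Notation vec R K n := (array R K 'I_n) (only parsing).
Notation tensor R K n d := (array R K {ffun 'I_d -> 'I_n}) (only parsing).

Definition inner (R : realType) (K : scalar_kind) (I : finType)
    (x y : array R K I) : base_field R K :=
  \sum_i x i * sconj (y i).

(* [inner x x] is a nonnegative real, so taking the real part only casts it
   from F to R. *)
Definition tnorm (R : realType) (K : scalar_kind) (I : finType)
    (x : array R K I) : R :=
  Num.sqrt (sre (inner x x)).

Definition tensor_prod (R : realType) (K : scalar_kind) (n d : nat)
    (v : 'I_d -> vec R K n) : tensor R K n d :=
  [ffun i : {ffun 'I_d -> 'I_n} => \prod_j v j (i j)].

Definition tensor_pow (R : realType) (K : scalar_kind) (n d : nat)
    (v : vec R K n) : tensor R K n d :=
  tensor_prod (fun _ => v).

Definition symmetric_tensor (R : realType) (K : scalar_kind) (n d : nat)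
    (T : tensor R K n d) : Prop :=
  forall (s : 'S_d) (i : {ffun 'I_d -> 'I_n}), T [ffun j => i (s j)] = T i.

Definition admissible (R : realType) (K : scalar_kind) (n d r : nat)
    (v : 'I_r -> 'I_d -> vec R K n) : Prop :=
  (forall k j, tnorm (v k j) = 1) /\
  (forall k k', k != k' -> forall j j', inner (v k j) (v k' j') = 0).

(* Main.v *)
(* For an admissible family w the tensors W_k = w_k1 (x) ... (x) w_kd are orthonormal (if d > 0), so the
   best coefficients are <T, W_k> and the squared error is |T|^2 - sum_k |<T, W_k>|^2.  By
   compactness, take w maximizing the gain sum_k |<T, W_k>|^2 and, among the maximizers, the
   spread sum_k |sum_j w_kj|^2.

   Let x = w_ki and y = w_kj, and let B(u, v) be <T, .> with u, v put in positions i, j of W_k;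
   it is symmetric.  On the orthogonal complement of the other blocks |B(z, z)| <= |B(x, y)| |z|^2,
   and polarization against the parallelogram law forces equality at z = x + y.  So replacing x and
   y by u = z / |z| keeps the gain.  With S = sum_j w_kj, flipping the sign of x or y shows that
   Re <S, x>, Re <S, y> >= 1; hence z <> 0, and the replacement would increase |S|^2 unless
   |z| = 2, that is x = y. *)
Require Import Defs.
From HB Require Import structures.
From mathcomp Require Import all_boot all_order all_algebra all_fingroup.
From mathcomp Require Import reals.
From mathcomp Require Import complex.
From mathcomp Require Import ring lra.
From mathcomp Require Import boolp classical_sets topology normedtype derive.
Set Implicit Arguments.
Unset Strict Implicit.
Unset Printing Implicit Defensive.
Import Order.TTheory GRing.Theory Num.Theory.
Import numFieldNormedType.Exports.
Local Open Scope ring_scope.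

(** * Real and imaginary parts, conjugation and order, uniformly over both fields *)

Section Scalars.
Variables (R : realType) (K : scalar_kind).
Local Notation F := (base_field R K).
Implicit Types x y : F.

(** The imaginary part, taken to be 0 over the reals so that identities in two real coordinates hold
    for both fields. *)
Definition sim : F -> R :=
  match K return base_field R K -> R with
  | RealScalars => fun=> 0
  | ComplexScalars => fun z : complex R => complex.Im z
  end.

Lemma sconj_is_zmod_morphism : zmod_morphism (@sconj R K).
Proof. by case: K => //= x y; rewrite rmorphB. Qed.

Lemma sconj_is_monoid_morphism : monoid_morphism (@sconj R K).
Proof. by case: K => //=; split=> [|x y]; rewrite ?rmorph1 ?rmorphM. Qed.

HB.instance Definition _ :=
  GRing.isZmodMorphism.Build F F (@sconj R K) sconj_is_zmod_morphism.
HB.instance Definition _ :=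
  GRing.isMonoidMorphism.Build F F (@sconj R K) sconj_is_monoid_morphism.

Lemma sre_is_zmod_morphism : zmod_morphism (@sre R K).
Proof. by case: K => //= [[a b] [c e]]. Qed.

HB.instance Definition _ :=
  GRing.isZmodMorphism.Build F R (@sre R K) sre_is_zmod_morphism.

Lemma sim_is_zmod_morphism : zmod_morphism sim.
Proof. by rewrite /sim; case: K => //= [x y|[a b] [c e]//]; rewrite subr0. Qed.

HB.instance Definition _ :=
  GRing.isZmodMorphism.Build F R sim sim_is_zmod_morphism.

Lemma sconjK : involutive (@sconj R K).
Proof. by case: K => // x; exact: conjcK. Qed.

Lemma mul_sconj x : x * sconj x = `|x| ^+ 2.
Proof.
case: K x => /= x; last by rewrite sqr_normc.
by rewrite real_normK ?num_real // expr2.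
Qed.

Lemma ge0_sconj x : 0 <= x -> sconj x = x.
Proof.
case: K x => //= -[a b] /ger0_Im /= ->.
by rewrite oppr0.
Qed.

Lemma sre_ge0 x : 0 <= x -> 0 <= sre x.
Proof. by case: K x => //= -[a b]; rewrite lecE /= => /andP[]. Qed.

(** The order of the complex numbers compares only elements with equal imaginary parts; nonnegative
    elements have imaginary part 0. This carries inequalities between [F] and the reals. *)
Lemma ge0_le_sre x y : 0 <= x -> 0 <= y -> (x <= y) = (sre x <= sre y).
Proof.
case: K x y => //= -[a b] [c e] /ger0_Im /= -> /ger0_Im /= ->.
by rewrite lecE /= eqxx.
Qed.

Lemma ge0_sqrt x : 0 <= x -> exists2 s, 0 <= s & s ^+ 2 = x.
Proof.
case: K x => /= x x0.
  by exists (Num.sqrt x); rewrite ?sqrtr_ge0 ?sqr_sqrtr.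
by exists (sqrtc x); rewrite ?sqrtc_ge0 ?sqr_sqrtc.
Qed.

Lemma sreM x y : sre (x * y) = sre x * sre y - sim x * sim y.
Proof.
by rewrite /sim; case: K x y => /= [x y|[a b] [c e] //]; rewrite mul0r subr0.
Qed.

Lemma simM x y : sim (x * y) = sre x * sim y + sim x * sre y.
Proof.
by rewrite /sim; case: K x y => /= [x y|[a b] [c e] //]; rewrite mul0r mulr0 addr0.
Qed.

Lemma sre_conj x : sre (sconj x) = sre x.
Proof. by case: K x => //= -[]. Qed.

Lemma sim_conj x : sim (sconj x) = - sim x.
Proof. by rewrite /sim; case: K x => /= [_|[]//]; rewrite oppr0. Qed.

Lemma scalar_eq x y : sre x = sre y -> sim x = sim y -> x = y.
Proof. by rewrite /sim; case: K x y => //= -[a b] [c e] /= -> ->. Qed.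

(** The squared modulus is the sum of the squares of the two parts. This later places bounded
    coordinates in the cube with sides [-1, 1]. *)
Lemma normC_parts x : `|x| ^+ 2 <= 1 -> `|sre x| <= 1 /\ `|sim x| <= 1.
Proof.
rewrite -mul_sconj ge0_le_sre ?mul_sconj ?exprn_ge0 // -mul_sconj sreM sim_conj sre_conj.
have -> : sre (1 : F) = 1 by case: K x.
move: (sre x) (sim x) => a b h; split; rewrite -(@ler_pXn2r _ 2) ?nnegrE //;
  rewrite real_normK ?num_real // expr1n; nra.
Qed.

End Scalars.

(** * The inner product and the norm *)

Section Inner.
Variables (R : realType) (K : scalar_kind) (I : finType).
Local Notation F := (base_field R K).
Implicit Types (x y z : array R K I) (a : F).

Lemma innerDl x y z : inner (x + y) z = inner x z + inner y z.
Proof. by rewrite /inner -big_split; apply: eq_bigr => i _; rewrite ffunE mulrDl. Qed.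

Lemma innerZl a x y : inner (a *: x) y = a * inner x y.
Proof. by rewrite /inner mulr_sumr; apply: eq_bigr => i _; rewrite ffunE mulrA. Qed.

Lemma innerC x y : inner y x = sconj (inner x y).
Proof.
rewrite /inner rmorph_sum; apply: eq_bigr => i _.
by rewrite rmorphM /= sconjK mulrC.
Qed.

Lemma innerDr x y z : inner z (x + y) = inner z x + inner z y.
Proof. by rewrite innerC innerDl rmorphD /= -!innerC. Qed.

Lemma innerZr a x y : inner y (a *: x) = sconj a * inner y x.
Proof. by rewrite innerC innerZl rmorphM /= -innerC. Qed.

Lemma innerNl x y : inner (- x) y = - inner x y.
Proof. by rewrite -scaleN1r innerZl mulN1r. Qed.

Lemma innerNr x y : inner y (- x) = - inner y x.
Proof. by rewrite innerC innerNl rmorphN /= -innerC. Qed.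

Lemma inner0l x : inner 0 x = 0.
Proof. by rewrite /inner big1 // => i _; rewrite ffunE mul0r. Qed.

Lemma inner_suml (J : finType) (P : pred J) (f : J -> array R K I) y :
  inner (\sum_(j | P j) f j) y = \sum_(j | P j) inner (f j) y.
Proof.
by apply: (big_morph (fun x => inner x y)) => [u v|]; rewrite ?innerDl ?inner0l.
Qed.

Lemma inner_sumr (J : finType) (P : pred J) (f : J -> array R K I) y :
  inner y (\sum_(j | P j) f j) = \sum_(j | P j) inner y (f j).
Proof.
by rewrite innerC inner_suml rmorph_sum /=; apply: eq_bigr => j _; rewrite -innerC.
Qed.

Lemma inner_self x : inner x x = \sum_i `|x i| ^+ 2.
Proof. by apply: eq_bigr => i _; rewrite mul_sconj. Qed.

Lemma inner_ge0 x : 0 <= inner x x.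
Proof. by rewrite inner_self sumr_ge0 // => i _; rewrite exprn_ge0. Qed.

Lemma inner_eq0 x : inner x x = 0 -> x = 0.
Proof.
rewrite inner_self => /eqP; rewrite psumr_eq0 => [|i _]; last by rewrite exprn_ge0.
move=> /allP x0; apply/ffunP => i; rewrite ffunE.
by have /eqP/eqP := x0 i (mem_index_enum i); rewrite sqrf_eq0 normr_eq0 => /eqP.
Qed.

Lemma inner_entry x i : `|x i| ^+ 2 <= inner x x.
Proof.
by rewrite inner_self (bigD1 i) //= lerDl sumr_ge0 // => j _; rewrite exprn_ge0.
Qed.

Lemma tnorm_le x y : inner x x <= inner y y -> tnorm x <= tnorm y.
Proof. by rewrite ge0_le_sre ?inner_ge0 // => h; rewrite /tnorm ler_wsqrtr. Qed.

Lemma tnorm_eq1 x : tnorm x = 1 <-> inner x x = 1.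
Proof.
have s1 : sre (1 : F) = 1 by case: K.
rewrite /tnorm; split=> [h|->]; last by rewrite s1 sqrtr1.
have e : sre (inner x x) = 1.
  by rewrite -[sre _]sqr_sqrtr ?h ?expr1n // sre_ge0 ?inner_ge0.
have le1 := ge0_le_sre (inner_ge0 x) (@ler01 F).
have ge1 := ge0_le_sre (@ler01 F) (inner_ge0 x).
by apply: le_anti; rewrite le1 ge1 e s1 lexx.
Qed.

Lemma parallelogram x y :
  inner (x + y) (x + y) + inner (x - y) (x - y) = 2 * (inner x x + inner y y).
Proof. by rewrite !(innerDl, innerDr, innerNl, innerNr); ring. Qed.

(** The norm is produced as a positive element of [F] rather than through [tnorm], so that it can
    scale vectors and enter inequalities in [F] directly. *)
Lemma normalize_exists z : z != 0 ->
  exists s u, [/\ 0 < s, s ^+ 2 = inner z z, inner u u = 1 & z = s *: u].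
Proof.
move=> z0; have [s s0 s2] := ge0_sqrt (inner_ge0 z).
have sN0 : s != 0.
  apply: contra_neq z0 => s0'; apply: inner_eq0.
  by rewrite -s2 s0' expr0n.
exists s, (s^-1 *: z); split=> //.
- by rewrite lt_def sN0.
- rewrite innerZl innerZr -s2 ge0_sconj ?invr_ge0 // mulrA -expr2.
  by rewrite -exprMn mulVf ?expr1n.
- by rewrite scalerA mulfV // scale1r.
Qed.

End Inner.

(** * Distance from a tensor to a combination of orthonormal tensors *)

Section Pythagoras.
Variables (R : realType) (K : scalar_kind) (I J : finType).
Local Notation F := (base_field R K).

(** Completing the square in each coefficient. Only the last sum depends on [a], and it vanishes at
    [a k = inner T (W k)]. *)
Lemma best_coefficients (T : array R K I) (W : J -> array R K I) (a : J -> F) :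
    (forall k l, inner (W k) (W l) = (k == l)%:R) ->
  inner (T - \sum_k a k *: W k) (T - \sum_k a k *: W k) =
  inner T T - \sum_k `|inner T (W k)| ^+ 2 + \sum_k `|a k - inner T (W k)| ^+ 2.
Proof.
move=> oW; set S := \sum_k _.
have TS : inner T S = \sum_k sconj (a k) * inner T (W k).
  by rewrite inner_sumr; apply: eq_bigr => k _; rewrite innerZr.
have SS : inner S S = \sum_k a k * sconj (a k).
  rewrite inner_suml; apply: eq_bigr => k _; rewrite innerZl; congr (_ * _).
  rewrite inner_sumr (bigD1 k) //= innerZr oW eqxx mulr1 big1 ?addr0 // => l lk.
  by rewrite innerZr oW eq_sym (negbTE lk) mulr0.
rewrite innerDl !innerDr !innerNl !innerNr (innerC T S) SS TS.
rewrite rmorph_sum /= -addrA -[in RHS]addrA; congr (_ + _).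
rewrite -!sumrN -!big_split /=; apply: eq_bigr => k _.
rewrite -!mul_sconj !(rmorphB, rmorphM) /= sconjK; ring.
Qed.

End Pythagoras.

(** * Rank-one tensors, replacement of two factors, and pairing with symmetric tensors *)

Section TensorProduct.
Variables (R : realType) (K : scalar_kind) (n d : nat).
Local Notation F := (base_field R K).
Implicit Types v w : 'I_d -> vec R K n.

Lemma inner_tensor_prod v w :
  inner (tensor_prod v) (tensor_prod w) = \prod_j inner (v j) (w j).
Proof.
rewrite /inner bigA_distr_bigA /=; apply: eq_bigr => i _.
by rewrite !ffunE rmorph_prod -big_split.
Qed.

Lemma eq_tensor_prod v w : v =1 w -> tensor_prod v = tensor_prod w.
Proof. by move=> e; apply/ffunP => a; rewrite !ffunE; apply: eq_bigr => j _; rewrite e. Qed.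

Definition upd2 w (i j : 'I_d) (x y : vec R K n) : 'I_d -> vec R K n :=
  fun l => if l == i then x else if l == j then y else w l.

Lemma upd2E w i j : upd2 w i j (w i) (w j) =1 w.
Proof. by rewrite /upd2 => l; case: eqP => [->|_] //; case: eqP => [->|]. Qed.

Lemma tensor_prod_upd2E w i j x y (a : {ffun 'I_d -> 'I_n}) : i != j ->
  tensor_prod (upd2 w i j x y) a =
  x (a i) * y (a j) * \prod_(l | (l != i) && (l != j)) w l (a l).
Proof.
move=> ij; rewrite ffunE (bigD1 i) //= (bigD1 j) ?(eq_sym j) //= mulrA.
congr (_ * _); first by rewrite /upd2 !eqxx eq_sym (negbTE ij).
by apply: eq_bigr => l /andP[/negbTE li /negbTE lj]; rewrite /upd2 li lj.
Qed.

(** The product is bilinear in the factors at positions i and j; the pure terms in x, x and y, y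
    cancel in the difference and the mixed ones double. *)
Lemma tensor_prod_polarization w i j x y : i != j ->
  tensor_prod (upd2 w i j (x + y) (x + y)) - tensor_prod (upd2 w i j (x - y) (x - y)) =
  2 *: (tensor_prod (upd2 w i j x y) + tensor_prod (upd2 w i j y x)) :> tensor R K n d.
Proof.
move=> ij; apply/ffunP => a.
have E (u v : tensor R K n d) : (u - v) a = u a - v a by rewrite !ffunE.
have E' (u v : tensor R K n d) : (2 *: (u + v)) a = 2 * (u a + v a) by rewrite !ffunE.
rewrite E E' !tensor_prod_upd2E // !ffunE.
set p := \prod_(l | _) _.
have E2 (b c e f q : F) :
  (b + c) * (e + f) * q - (b - c) * (e - f) * q = 2 * (b * f * q + c * e * q) by ring.
exact: E2.
Qed.

Lemma tensor_prod_scale2 w i j a b x y : i != j ->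
  tensor_prod (upd2 w i j (a *: x) (b *: y)) =
  (a * b) *: tensor_prod (upd2 w i j x y) :> tensor R K n d.
Proof.
move=> ij; apply/ffunP => c.
have E (u : tensor R K n d) : ((a * b) *: u) c = a * b * u c by rewrite !ffunE.
rewrite E !tensor_prod_upd2E // !ffunE.
have E2 (e f g h q : F) : (e * g) * (f * h) * q = e * f * (g * h * q) by ring.
exact: E2.
Qed.

(** Reindexing the sum over multi-indices by [s] moves the permutation from the factors onto [T],
    which absorbs it. *)
Lemma symmetric_inner_perm (T : tensor R K n d) (s : 'S_d) v :
  symmetric_tensor T ->
  inner T (tensor_prod (v \o s)) = inner T (tensor_prod v).
Proof.
move=> hT; rewrite /inner.
pose g (t : 'S_d) (a : {ffun 'I_d -> 'I_n}) := [ffun j => a (t j)].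
have gK : cancel (g s^-1%g) (g s) by move=> a; apply/ffunP => j; rewrite !ffunE permK.
have gK' : cancel (g s) (g s^-1%g) by move=> a; apply/ffunP => j; rewrite !ffunE permKV.
rewrite (reindex (g s)) /=; last by apply: onW_bij; exists (g s^-1%g).
apply: eq_bigr => a _; rewrite hT; congr (_ * sconj _).
rewrite !ffunE [RHS](reindex_inj (@perm_inj _ s)) /=.
by apply: eq_bigr => j _; rewrite ffunE.
Qed.

Lemma symmetric_inner_swap (T : tensor R K n d) w i j x y :
  symmetric_tensor T -> i != j ->
  inner T (tensor_prod (upd2 w i j x y)) = inner T (tensor_prod (upd2 w i j y x)).
Proof.
move=> hT ij; rewrite -(symmetric_inner_perm (tperm i j) _ hT).
congr (inner T _); apply: eq_tensor_prod => l; rewrite /upd2 /=.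
case: tpermP => [->|->|/eqP/negbTE li /eqP/negbTE lj].
- by rewrite !eqxx eq_sym (negbTE ij).
- by rewrite !eqxx [j == i]eq_sym (negbTE ij).
- by rewrite li lj.
Qed.

End TensorProduct.

(** * Compactness and maxima on bounded zero sets *)

Lemma compact_cube (R : realType) (J : eqType) (a b : R) :
  compact [set p : prod_topology (fun _ : J => R) | forall j, `[a, b]%classic (p j)]%classic.
Proof.
by apply: (@tychonoff J (fun=> R) (fun=> `[a, b]%classic)) => j; exact: segment_compact.
Qed.

Section Maximum.
Variables (R : realType) (K : scalar_kind) (J : finType).
Local Notation F := (base_field R K).
Local Notation param := (prod_topology (fun _ : J * bool => R)).

Definition scalar_of_parts (a b : R) : F :=
  match K return base_field R K with
  | RealScalars => a
  | ComplexScalars => Complex a b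
  end.

Lemma sre_of_parts a b : sre (scalar_of_parts a b) = a.
Proof. by rewrite /scalar_of_parts; case: K. Qed.

Lemma scalar_of_partsK (x : F) : scalar_of_parts (sre x) (sim x) = x.
Proof. by rewrite /scalar_of_parts /sim; case: K x => //= -[]. Qed.

(** Points with coordinates in [F] are parametrized by a real power, the boolean selecting the real
    or imaginary part, so that compactness is needed only for real cubes. *)
Definition decode (p : param) : J -> F :=
  fun j => scalar_of_parts (p (j, true)) (p (j, false)).

Definition encode (x : J -> F) : param :=
  fun jb => if jb.2 then sre (x jb.1) else sim (x jb.1).

Lemma encodeK : cancel encode decode.
Proof. by move=> x; apply/funext => j; rewrite /decode /= scalar_of_partsK. Qed.

(** Continuity is tested on the two real parts as functions of real parameters, so one argument
    serves both fields. *)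
Definition continuous_in_parts (G : (J -> F) -> F) :=
  continuous (fun p : param => sre (G (decode p))) /\
  continuous (fun p : param => sim (G (decode p))).

Lemma continuous_parts_cst a : continuous_in_parts (fun=> a).
Proof. by split; apply: (@cst_continuous param R). Qed.

Lemma eq_continuous (f g : param -> R) : f =1 g -> continuous f -> continuous g.
Proof. by move=> /funext ->. Qed.

Lemma continuous_parts_coord j : continuous_in_parts (fun x => x j).
Proof.
split.
  apply: (@eq_continuous (fun p => p (j, true))) => [p|].
    by rewrite /decode sre_of_parts.
  exact: (@proj_continuous _ (fun _ : J * bool => R) (j, true)).
rewrite /decode /scalar_of_parts /sim; case: K => /=.
  exact: (@cst_continuous param R).
exact: (@proj_continuous _ (fun _ : J * bool => R) (j, false)).
Qed.

Lemma continuous_partsD G H : continuous_in_parts G -> continuous_in_parts H ->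
  continuous_in_parts (fun x => G x + H x).
Proof.
move=> [Gr Gi] [Hr Hi]; split.
  apply: (@eq_continuous (fun p => sre (G (decode p)) + sre (H (decode p)))).
    by move=> p; rewrite raddfD.
  by move=> p; exact: continuousD (Gr p) (Hr p).
apply: (@eq_continuous (fun p => sim (G (decode p)) + sim (H (decode p)))).
  by move=> p; rewrite raddfD.
by move=> p; exact: continuousD (Gi p) (Hi p).
Qed.

Lemma continuous_partsM G H : continuous_in_parts G -> continuous_in_parts H ->
  continuous_in_parts (fun x => G x * H x).
Proof.
move=> [Gr Gi] [Hr Hi]; split.
  apply: (@eq_continuous (fun p => sre (G (decode p)) * sre (H (decode p)) -
                                   sim (G (decode p)) * sim (H (decode p)))).
    by move=> p; rewrite sreM.
  by move=> p; exact: continuousB (continuousM (Gr p) (Hr p)) (continuousM (Gi p) (Hi p)).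
apply: (@eq_continuous (fun p => sre (G (decode p)) * sim (H (decode p)) +
                                 sim (G (decode p)) * sre (H (decode p)))).
  by move=> p; rewrite simM.
by move=> p; exact: continuousD (continuousM (Gr p) (Hi p)) (continuousM (Gi p) (Hr p)).
Qed.

Lemma continuous_parts_conj G : continuous_in_parts G ->
  continuous_in_parts (fun x => sconj (G x)).
Proof.
move=> [Gr Gi]; split.
  by apply: eq_continuous Gr => p; rewrite sre_conj.
apply: (@eq_continuous (fun p => - sim (G (decode p)))).
  by move=> p; rewrite sim_conj.
by move=> p; exact: continuousN (Gi p).
Qed.

Lemma eq_continuous_parts G H : G =1 H ->
  continuous_in_parts G -> continuous_in_parts H.
Proof. by move=> /funext ->. Qed.

Lemma continuous_parts_sum (L : finType) (G : L -> (J -> F) -> F) :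
  (forall l, continuous_in_parts (G l)) ->
  continuous_in_parts (fun x => \sum_l G l x).
Proof.
move=> cG; elim: (index_enum L) => [|l s IHs].
  by apply: eq_continuous_parts (continuous_parts_cst 0) => x; rewrite big_nil.
by apply: eq_continuous_parts (continuous_partsD (cG l) IHs) => x; rewrite big_cons.
Qed.

Lemma continuous_parts_prod (L : finType) (G : L -> (J -> F) -> F) :
  (forall l, continuous_in_parts (G l)) ->
  continuous_in_parts (fun x => \prod_l G l x).
Proof.
move=> cG; elim: (index_enum L) => [|l s IHs].
  by apply: eq_continuous_parts (continuous_parts_cst 1) => x; rewrite big_nil.
by apply: eq_continuous_parts (continuous_partsM (cG l) IHs) => x; rewrite big_cons.
Qed.

(** The zero set is closed, being an intersection of preimages of 0 under continuous real functions,
    and the bound places its encoding in a compact cube; the extreme value theorem applies. The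
    index type [Z] is arbitrary so that equations can be added. *)
Lemma max_on_bounded_zero_set (Z : Type) (eqn : Z -> (J -> F) -> F)
    (f : (J -> F) -> F) (x0 : J -> F) :
    (forall z, continuous_in_parts (eqn z)) -> continuous_in_parts f ->
    (forall z, eqn z x0 = 0) ->
    (forall x, (forall z, eqn z x = 0) -> forall j, `|x j| ^+ 2 <= 1) ->
  exists2 x, (forall z, eqn z x = 0) &
    forall y, (forall z, eqn z y = 0) -> sre (f y) <= sre (f x).
Proof.
move=> ceqn [cf _] x00 bnd.
pose box := [set p : param | forall jb, `[-1 : R, 1 : R]%classic (p jb)]%classic.
pose A := [set p : param | forall z, eqn z (decode p) = 0]%classic.
have cbox : compact box.
  exact: compact_cube.
have clA : closed A.
  have -> : A = (\bigcap_z ([set p | sre (eqn z (decode p)) = 0] `&`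
                            [set p | sim (eqn z (decode p)) = 0]))%classic.
    apply/seteqP; split=> p /= h z; first by move=> _; rewrite /setI /= h !raddf0.
    by have [] := h z I => hr hi; apply: scalar_eq; rewrite ?hr ?hi raddf0.
  apply: closed_bigI => z _; have [cr ci] := ceqn z.
  by apply: closedI; apply: (@closed_comp _ _ _ [set 0]%classic) => // [p _|]; exact: closed_eq.
(* Each solution need only have one parameter point in the box, and [encode] supplies it. *)
have inbox x : (forall z, eqn z x = 0) -> (box `&` A)%classic (encode x).
  move=> ex; split=> [[j b]|z]; last by rewrite encodeK.
  by have [] := normC_parts (bnd x ex j); rewrite !ler_norml /encode /= in_itv; case: b.
have [] := @compact_EVT_max param R (fun p => sre (f (decode p))) (box `&` A)%classic.
- by exists (encode x0); exact: inbox.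
- exact: compact_closedI.
- exact: continuous_subspaceT.
move=> p; rewrite inE => -[_ pA] pmax; exists (decode p) => // y ey.
by have := pmax (encode y); rewrite inE encodeK; apply; exact: inbox.
Qed.

End Maximum.

(** * Gain, spread and the existence of a lexicographic maximizer *)

Section Symmetrization.
Variables (R : realType) (K : scalar_kind) (n d r : nat) (T : tensor R K n d).
Local Notation F := (base_field R K).
Implicit Types w : 'I_r -> 'I_d -> vec R K n.

(** Kept in [F], where it is a nonnegative real, so that fixing its value is one more equation for
    [max_on_bounded_zero_set]. *)
Definition gain w : F := \sum_k `|inner T (tensor_prod (w k))| ^+ 2.

Definition spread w : F := \sum_k inner (\sum_j w k j) (\sum_j w k j).

Lemma gain_ge0 w : 0 <= gain w.
Proof. by apply: sumr_ge0 => k _; rewrite exprn_ge0. Qed.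

Lemma spread_ge0 w : 0 <= spread w.
Proof. by apply: sumr_ge0 => k _; rewrite inner_ge0. Qed.

Lemma admissible_inner w : admissible w <->
  (forall k j, inner (w k j) (w k j) = 1) /\
  (forall k k', k != k' -> forall j j', inner (w k j) (w k' j') = 0).
Proof. by split=> -[h1 h2]; split=> // k j; apply/tnorm_eq1. Qed.

Local Notation J := ('I_r * 'I_d * 'I_n)%type.

Definition family_of (x : J -> F) : 'I_r -> 'I_d -> vec R K n :=
  fun k j => [ffun i => x (k, j, i)].

Lemma family_of_surj w : exists x, family_of x = w.
Proof.
exists (fun t => w t.1.1 t.1.2 t.2).
by apply/funext => k; apply/funext => j; apply/ffunP => i; rewrite ffunE.
Qed.

Lemma continuous_inner (I : finType) (u v : (J -> F) -> array R K I) :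
    (forall i, continuous_in_parts (fun x => u x i)) ->
    (forall i, continuous_in_parts (fun x => v x i)) ->
  continuous_in_parts (fun x => inner (u x) (v x)).
Proof.
move=> cu cv; apply: continuous_parts_sum => i.
by apply: continuous_partsM => //; apply: continuous_parts_conj.
Qed.

Lemma continuous_family k j i : continuous_in_parts (fun x => family_of x k j i).
Proof.
apply: (@eq_continuous_parts R K _ (fun x => x (k, j, i))) => [x|].
  by rewrite ffunE.
exact: continuous_parts_coord.
Qed.

Lemma continuous_gain : continuous_in_parts (fun x => gain (family_of x)).
Proof.
apply: continuous_parts_sum => k.
have c : continuous_in_parts (fun x => inner T (tensor_prod (family_of x k))).
  apply: continuous_inner => i; first exact: continuous_parts_cst.
  apply: (@eq_continuous_parts _ _ _ (fun x => \prod_j family_of x k j (i j))).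
    by move=> x; rewrite ffunE.
  by apply: continuous_parts_prod => j; exact: continuous_family.
apply: eq_continuous_parts (continuous_partsM c (continuous_parts_conj c)) => x.
by rewrite mul_sconj.
Qed.

Lemma continuous_spread : continuous_in_parts (fun x => spread (family_of x)).
Proof.
apply: continuous_parts_sum => k.
have c i : continuous_in_parts (fun x => (\sum_j family_of x k j) i).
  apply: (@eq_continuous_parts _ _ _ (fun x => \sum_j family_of x k j i)).
    by move=> x; rewrite sum_ffunE.
  by apply: continuous_parts_sum => j; exact: continuous_family.
exact: continuous_inner.
Qed.

(** Presents the admissible families as a zero set: indices with [k = k'] carry unit length, the
    others orthogonality between blocks. *)
Definition admissible_eqn (z : 'I_r * 'I_r * 'I_d * 'I_d) (x : J -> F) : F :=
  let: (k, k', j, j') := z in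
  if k == k' then inner (family_of x k j) (family_of x k j) - 1
  else inner (family_of x k j) (family_of x k' j').

Lemma admissible_eqnP x : (forall z, admissible_eqn z x = 0) <-> admissible (family_of x).
Proof.
rewrite admissible_inner /admissible_eqn; split=> [h|[h1 h2] [[[k k'] j] j']].
  split=> [k j|k k' kk' j j'].
    by have /eqP := h (k, k, j, j); rewrite eqxx subr_eq0 => /eqP.
  by have := h (k, k', j, j'); rewrite (negbTE kk').
by case: eqVneq => [_|/h2//]; rewrite h1 subrr.
Qed.

Lemma continuous_admissible_eqn z : continuous_in_parts (admissible_eqn z).
Proof.
case: z => [[[k k'] j] j']; rewrite /admissible_eqn; case: (k == k').
  apply: continuous_partsD; last exact: continuous_parts_cst.
  by apply: continuous_inner => i; exact: continuous_family.
by apply: continuous_inner => i; exact: continuous_family.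
Qed.

Lemma admissible_bounded x : admissible (family_of x) -> forall t, `|x t| ^+ 2 <= 1.
Proof.
move=> /admissible_inner[h _] [[k j] i].
by have := inner_entry (family_of x k j) i; rewrite h ffunE.
Qed.

(** Two successive maximizations: the gain over the admissible families, then the spread over those
    attaining the maximal gain, again a bounded zero set. *)
Lemma lexicographic_maximizer : (exists w, admissible w) ->
  exists w, [/\ admissible w, forall w', admissible w' -> gain w' <= gain w &
    forall w', admissible w' -> gain w' = gain w -> spread w' <= spread w].
Proof.
move=> [w0 aw0]; have [x0 x0w0] := family_of_surj w0.
rewrite -x0w0 in aw0.
have [x1 /admissible_eqnP ax1 x1max] := max_on_bounded_zero_set
  continuous_admissible_eqn continuous_gain ((admissible_eqnP x0).2 aw0)
  (fun x hx => admissible_bounded ((admissible_eqnP x).1 hx)).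
(* The added index [None] carries the equation that fixes the gain at its maximum. *)
pose eqn' z x := if z is Some z' then admissible_eqn z' x
                 else gain (family_of x) - gain (family_of x1).
have eqn'P x : (forall z, eqn' z x = 0) <->
    admissible (family_of x) /\ gain (family_of x) = gain (family_of x1).
  split=> [h|[/admissible_eqnP ha hg] [z|]]; last by rewrite /= hg subrr.
    split; first by apply/admissible_eqnP => z; exact: (h (Some z)).
    by apply/eqP; rewrite -subr_eq0; apply/eqP; exact: (h None).
  exact: ha.
have ceqn' z : continuous_in_parts (eqn' z).
  case: z => [z|]; first exact: continuous_admissible_eqn.
  by apply: continuous_partsD; [exact: continuous_gain|exact: continuous_parts_cst].
have [x2 /eqn'P[ax2 gx2] x2max] := max_on_bounded_zero_set ceqn' continuous_spread
  ((eqn'P x1).2 (conj ax1 erefl))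
  (fun x hx => admissible_bounded ((eqn'P x).1 hx).1).
exists (family_of x2); rewrite gx2; split=> // w; have [x <-] := family_of_surj w.
  by move=> ax; rewrite ge0_le_sre ?gain_ge0 //; apply: x1max; apply/admissible_eqnP.
move=> ax gx; rewrite ge0_le_sre ?spread_ge0 //; apply: x2max.
exact/eqn'P.
Qed.

Definition replace w k (v : 'I_d -> vec R K n) : 'I_r -> 'I_d -> vec R K n :=
  fun k' => if k' == k then v else w k'.

Lemma sum_replace (G : ('I_d -> vec R K n) -> F) w k v :
  \sum_k' G (replace w k v k') = G v + \sum_(k' | k' != k) G (w k').
Proof.
rewrite (bigD1 k) //= /replace eqxx; congr (_ + _).
by apply: eq_bigr => k' /negbTE ->.
Qed.

Lemma sum_upd2 (v : 'I_d -> vec R K n) i j x y : i != j ->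
  \sum_l upd2 v i j x y l = \sum_l v l + (x - v i) + (y - v j).
Proof.
move=> ij; have ji : j != i by rewrite eq_sym.
rewrite (bigD1 i) //= (bigD1 j) //= [\sum_l v l](bigD1 i) //= [\sum_(l | l != i) v l](bigD1 j) //=.
rewrite {1 2}/upd2 !eqxx (negbTE ji).
rewrite (eq_bigr v) => [|l /andP[/negbTE li /negbTE lj]]; last by rewrite /upd2 li lj.
move: (\sum_(_ | _) _) (v i) (v j) => s a b.
have -> : a + (b + s) + (x - a) = b + (s + x).
  by rewrite addrC addrA subrK addrCA [x + s]addrC.
by rewrite [RHS]addrC [RHS]addrA subrK [LHS]addrCA [x + s]addrC.
Qed.

Definition orthogonal_to_others w k (x : vec R K n) :=
  forall k' l, k' != k -> inner x (w k' l) = 0.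

(** Admissibility imposes no relation between vectors of the same block, so only their lengths and
    the other blocks need checking. *)
Lemma admissible_replace w k i j x y : admissible w ->
    inner x x = 1 -> inner y y = 1 ->
    orthogonal_to_others w k x -> orthogonal_to_others w k y ->
  admissible (replace w k (upd2 (w k) i j x y)).
Proof.
move=> /admissible_inner[h1 h2] x1 y1 ox oy; apply/admissible_inner.
have o k' l l' : k' != k -> inner (upd2 (w k) i j x y l) (w k' l') = 0.
  move=> k'k; rewrite /upd2; case: eqP => _; first exact: ox.
  by case: eqP => _; [exact: oy|apply: h2; rewrite eq_sym].
split=> [k' l|k1 k2 k12 l l']; rewrite /replace.
  by case: eqP => // _; rewrite /upd2; case: eqP => // _; case: eqP.
case: (eqVneq k1 k) k12 => [-> kk2|k1k k12].
  by rewrite eq_sym (negbTE kk2) o // eq_sym.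
by case: eqP => [_|_]; [rewrite innerC o // rmorph0|exact: h2].
Qed.

End Symmetrization.

(** * Exchanging two vectors within one block of a maximizer *)

Section PairExchange.
Variables (R : realType) (K : scalar_kind) (n d r : nat) (T : tensor R K n d).
Local Notation F := (base_field R K).
Variable w : 'I_r -> 'I_d -> vec R K n.
Hypothesis hT : symmetric_tensor T.
Hypothesis aw : admissible w.
Hypothesis gmax : forall w' : 'I_r -> 'I_d -> vec R K n, admissible w' -> gain T w' <= gain T w.
Hypothesis smax : forall w' : 'I_r -> 'I_d -> vec R K n,
  admissible w' -> gain T w' = gain T w -> spread w' <= spread w.
Variables (k : 'I_r) (i j : 'I_d).
Hypothesis ij : i != j.

Local Notation x := (w k i).
Local Notation y := (w k j).
Local Notation B u v := (inner T (tensor_prod (upd2 (w k) i j u v))).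
Local Notation S := (\sum_l w k l).
Local Notation orth := (orthogonal_to_others w k).

Lemma pair_form : B x y = inner T (tensor_prod (w k)).
Proof. by rewrite (eq_tensor_prod (upd2E (w k) i j)). Qed.

(** The other blocks contribute equally to both gains, so maximality of the gain compares the terms
    of block [k] alone. *)
Lemma pair_form_le u v : inner u u = 1 -> inner v v = 1 -> orth u -> orth v ->
  `|B u v| <= `|B x y|.
Proof.
move=> u1 v1 ou ov; have := gmax (admissible_replace i j aw u1 v1 ou ov).
rewrite /gain (sum_replace (fun v => `|inner T (tensor_prod v)| ^+ 2)).
by rewrite [leRHS](bigD1 k) //= lerD2r pair_form ler_pXn2r ?nnegrE.
Qed.

(** The exchange keeps the gain, so maximality of the spread applies; again only the term of block
    [k] changes. *)
Lemma pair_exchange_spread u v :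
    inner u u = 1 -> inner v v = 1 -> orth u -> orth v -> `|B u v| = `|B x y| ->
  inner (S + (u - x) + (v - y)) (S + (u - x) + (v - y)) <= inner S S.
Proof.
move=> u1 v1 ou ov Buv; set w' := replace w k (upd2 (w k) i j u v).
have gw' : gain T w' = gain T w.
  rewrite /gain (sum_replace (fun v => `|inner T (tensor_prod v)| ^+ 2)).
  by rewrite [RHS](bigD1 k) //= Buv pair_form.
have := smax (admissible_replace i j aw u1 v1 ou ov) gw'.
rewrite /spread (sum_replace (fun v => inner (\sum_l v l) (\sum_l v l))).
by rewrite [leRHS](bigD1 k) //= lerD2r sum_upd2.
Qed.

Lemma unit_w l : inner (w k l) (w k l) = 1.
Proof. by move/admissible_inner: aw => [h _]; apply: h. Qed.

Lemma orth_w l : orth (w k l).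
Proof.
by move=> k' l' k'k; move/admissible_inner: aw => [_ h]; apply: h; rewrite eq_sym.
Qed.

Lemma orthD u v : orth u -> orth v -> orth (u + v).
Proof. by move=> ou ov k' l kk'; rewrite innerDl ou ?ov ?addr0. Qed.

Lemma orthZ (a : F) u : orth u -> orth (a *: u).
Proof. by move=> ou k' l kk'; rewrite innerZl ou ?mulr0. Qed.

Lemma orthN u : orth u -> orth (- u).
Proof. by rewrite -scaleN1r; exact: orthZ. Qed.

Lemma pair_formZ a b u v : B (a *: u) (b *: v) = sconj (a * b) * B u v.
Proof. by rewrite tensor_prod_scale2 // innerZr. Qed.

(** By homogeneity this reduces to a unit vector placed in both positions, where [pair_form_le]
    applies; z = 0 is treated apart. *)
Lemma diagonal_form_le z : orth z -> `|B z z| <= `|B x y| * inner z z.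
Proof.
move=> oz; have [->|/normalize_exists[s [u [s0 s2 u1 zu]]]] := eqVneq z 0.
  by rewrite -(scale0r (0 : vec R K n)) pair_formZ mul0r rmorph0 mul0r normr0
    scale0r inner0l mulr0.
have ou : orth u.
  have -> : u = s^-1 *: z by rewrite zu scalerA mulVf ?gt_eqF // scale1r.
  exact: orthZ.
have s2_ge0 : 0 <= s ^+ 2 by rewrite exprn_ge0 ?(ltW s0).
rewrite -s2 zu pair_formZ -expr2 ge0_sconj //.
rewrite normrM ger0_norm // mulrC ler_pM2r ?exprn_gt0 //.
exact: pair_form_le.
Qed.

(* With M = |B(x,y)|, equality holds throughout
   4 M <= |B(x+y,x+y)| + |B(x-y,x-y)| <= M (|x+y|^2 + |x-y|^2) = 4 M. *)
Lemma diagonal_form_sum : `|B (x + y) (x + y)| = `|B x y| * inner (x + y) (x + y).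
Proof.
apply: le_anti; rewrite diagonal_form_le /=; last exact/orthD/orth_w/orth_w.
have Bm : `|B (x - y) (x - y)| <= `|B x y| * inner (x - y) (x - y).
  by apply: diagonal_form_le; apply: orthD; [|apply: orthN]; exact: orth_w.
(* Polarization gives 2 (B(x, y) + B(y, x)), and the symmetry of [T] identifies the two terms. *)
have pol : B (x + y) (x + y) - B (x - y) (x - y) = 4 * B x y.
  rewrite -innerNr -innerDr tensor_prod_polarization // innerZr innerDr.
  rewrite [X in _ + X]symmetric_inner_swap // rmorph_nat; ring.
have pll := parallelogram x y; rewrite !unit_w in pll.
have -> : inner (x + y) (x + y) = 4 - inner (x - y) (x - y).
  apply/eqP; rewrite eq_sym subr_eq pll; apply/eqP; ring.
rewrite mulrBr lerBlDr.
apply: (@le_trans _ _ (`|B (x + y) (x + y)| + `|B (x - y) (x - y)|)).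
  by rewrite -[4]normr_nat mulrC -normrM -pol ler_normB.
by rewrite lerD2l.
Qed.

(* Flipping the sign of one factor cannot increase |S|^2. *)
Lemma spread_correlation : 2 <= inner S x + inner x S.
Proof.
have := @pair_exchange_spread (- x) y.
rewrite innerNl innerNr opprK !unit_w subrr addr0.
have -> : B (- x) y = - B x y.
  by rewrite -scaleN1r -[y in LHS]scale1r pair_formZ mulr1 rmorphN1 mulN1r.
rewrite normrN => /(_ erefl erefl (orthN (@orth_w i)) (@orth_w j) erefl).
rewrite !(innerDl, innerDr, innerNl, innerNr) !unit_w.
set p := inner S x; set q := inner x S; set s := inner S S.
(* Here e is |S|^2 - |S - 2x|^2, since flipping x changes S into S - 2x. *)
rewrite -subr_ge0; set e := (e in 0 <= e) => e0.
have E : e = 2 * (p + q - 2) by rewrite /e; ring.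
by rewrite E pmulr_rge0 // subr_ge0 in e0.
Qed.

End PairExchange.

(** Putting u = z / |z| in place of both x and y, with z = x + y, turns S into S + c z with c = 2 /
    |z| - 1. As Re <S, z> > 0, maximality of the spread forces c <= 0, so |z| >= 2, and the
    parallelogram law leaves x = y. *)
Lemma maximizer_factors_eq (R : realType) (K : scalar_kind) (n d r : nat)
    (T : tensor R K n d) (w : 'I_r -> 'I_d -> vec R K n) :
    symmetric_tensor T -> admissible w ->
    (forall w' : 'I_r -> 'I_d -> vec R K n, admissible w' -> gain T w' <= gain T w) ->
    (forall w' : 'I_r -> 'I_d -> vec R K n,
       admissible w' -> gain T w' = gain T w -> spread w' <= spread w) ->
  forall k i j, w k i = w k j.
Proof.
move=> hT aw gmax smax k i j; have [->//|ij] := eqVneq i j.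
set x := w k i; set y := w k j; set S := \sum_l w k l.
have Px := spread_correlation aw smax k ij.
have Py : 2 <= inner S y + inner y S.
  by apply: (spread_correlation aw smax k (j := i)); rewrite eq_sym.
rewrite -/x -/S in Px.
set z := x + y; set P := inner S z + inner z S.
have P4 : 4 <= P.
  have -> : P = (inner S x + inner x S) + (inner S y + inner y S).
    by rewrite /P innerDr innerDl addrACA.
  have -> : 4 = 2 + 2 :> base_field R K by ring.
  exact: lerD.
have z0 : z != 0.
  apply: contraTneq P4 => z0; rewrite /P z0 innerC inner0l rmorph0 addr0.
  by rewrite lern0.
have [s [u [s0 s2 u1 zu]]] := normalize_exists z0.
have oz : orthogonal_to_others w k z by apply: orthD; exact: orth_w.
have ou : orthogonal_to_others w k u.
  have -> : u = s^-1 *: z by rewrite zu scalerA mulVf ?gt_eqF // scale1r.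
  exact: orthZ.
(* Cancel s^2 from |B(z, z)| = |B(x, y)| s^2, where B(z, z) = s^2 B(u, u). *)
have Bu : `|inner T (tensor_prod (upd2 (w k) i j u u))| =
          `|inner T (tensor_prod (upd2 (w k) i j x y))|.
  have := diagonal_form_sum hT aw gmax k ij; rewrite -/x -/y -/z -s2 {1 2}zu.
  rewrite pair_formZ // -expr2 ge0_sconj ?exprn_ge0 ?(ltW s0) //.
  rewrite normrM ger0_norm ?exprn_ge0 ?(ltW s0) // mulrC.
  by apply: mulIf; rewrite expf_neq0 ?gt_eqF.
have := pair_exchange_spread aw smax ij u1 u1 ou ou Bu.
rewrite -/x -/y -/S; set c := 2 / s - 1.
have c_conj : sconj c = c.
  by rewrite rmorphB rmorph1 /= ge0_sconj // divr_ge0 ?ler0n ?(ltW s0).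
have -> : S + (u - x) + (u - y) = S + c *: z.
  rewrite -!addrA; congr (_ + _).
  have -> : c *: z = u + u - z.
    rewrite /c scalerBl scale1r {1}zu scalerA mulfVK ?gt_eqF //.
    by rewrite scaler_nat mulr2n.
  by rewrite /z opprD addrACA addrA.
rewrite innerDl 2!innerDr !innerZl !innerZr c_conj -s2 => hle.
(* The left side is |S + c z|^2 - |S|^2, as c is its own conjugate and s^2 = |z|^2. *)
have cle : c * P + c ^+ 2 * s ^+ 2 <= 0.
  rewrite -(lerD2l (inner S S)) addr0; apply: le_trans hle.
  by rewrite le_eqVlt; apply/orP; left; apply/eqP; rewrite /P; ring.
(* The order on [F] may be partial, so refuting 0 < c gives c <= 0 only for real c. *)
have c_real : c \is Num.real.
  by rewrite rpredB ?rpred1 ?rpred_div ?rpred_nat ?gtr0_real.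
have c_le0 : c <= 0.
  rewrite real_leNgt ?rpred0 //; apply/negP => c0.
  have : 0 < c * P + c ^+ 2 * s ^+ 2.
    rewrite ltr_wpDr ?mulr_ge0 ?exprn_ge0 ?(ltW s0) ?(ltW c0) //.
    by rewrite mulr_gt0 // (lt_le_trans _ P4) ?ltr0n.
  by move=> /lt_le_trans /(_ cle); rewrite ltxx.
have s_ge2 : 2 <= s.
  by move: c_le0; rewrite subr_le0 ler_pdivrMr // mul1r.
have s4 : 4 <= s ^+ 2.
  have -> : 4 = 2 ^+ 2 :> base_field R K by ring.
  by rewrite ler_pXn2r ?nnegrE ?ler0n ?(ltW s0).
apply/eqP; rewrite -subr_eq0; apply/eqP/inner_eq0/le_anti.
rewrite inner_ge0 andbT.
have pll := parallelogram x y; rewrite !unit_w // -s2 in pll.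
have -> : inner (x - y) (x - y) = 4 - s ^+ 2.
  by apply/eqP; rewrite eq_sym subr_eq addrC pll; apply/eqP; ring.
by rewrite subr_le0.
Qed.

(** * Orthonormal rank-one terms, existence of admissible families, and the conclusion *)

Lemma admissible_orthonormal (R : realType) (K : scalar_kind) (n d r : nat)
    (w : 'I_r -> 'I_d -> vec R K n) : (0 < d)%N -> admissible w ->
  forall k l, inner (tensor_prod (w k)) (tensor_prod (w l)) = (k == l)%:R.
Proof.
move=> d0 /admissible_inner[w1 w0] k l; rewrite inner_tensor_prod.
have [<-|kl] := eqVneq k l; first by rewrite big1.
(* One vanishing factor suffices, and [0 < d] provides position 0; an empty product would be 1. *)
by rewrite (bigD1 (Ordinal d0)) //= w0 // mul0r.
Qed.

(** The first r standard basis vectors, repeated at every position; this is where [r <= n]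
    enters. *)
Lemma admissible_exists (R : realType) (K : scalar_kind) (n d r : nat) :
  (r <= n)%N -> exists w : 'I_r -> 'I_d -> vec R K n, admissible w.
Proof.
move=> hr; pose e (k : 'I_r) : vec R K n := [ffun i => (i == widen_ord hr k)%:R].
have ee k l : inner (e k) (e l) = (k == l)%:R.
  rewrite /inner (bigD1 (widen_ord hr k)) //= big1 ?addr0 => [|i /negbTE ik].
    by rewrite !ffunE eqxx mul1r rmorph_nat -val_eqE.
  by rewrite !ffunE ik mul0r.
exists (fun k _ => e k); apply/admissible_inner; split=> [k j|k l kl j j'].
  by rewrite ee eqxx.
by rewrite ee (negbTE kl).
Qed.

Theorem theorem4p11 (R : realType) (K : scalar_kind) (n d r : nat)
    (hr : (r <= n)%N) (T : tensor R K n d) (hT : symmetric_tensor T) :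
  exists (sigma : 'I_r -> base_field R K) (v : 'I_r -> vec R K n),
    admissible (fun (k : 'I_r) (_ : 'I_d) => v k) /\
    forall (tau : 'I_r -> base_field R K) (w : 'I_r -> 'I_d -> vec R K n),
      admissible w ->
      tnorm (T - \sum_k sigma k *: tensor_pow d (v k)) <=
      tnorm (T - \sum_k tau k *: tensor_prod (w k)).
Proof.
case: d T hT => [|d] T hT.
  (* Every order-0 tensor product is the scalar 1, so one term represents T exactly. *)
  case: r hr => [|r] hr.
    exists (fun=> 0), (fun=> 0); split; first by split=> [[]|[]].
    by move=> tau w _; rewrite !big_ord0.
  pose a0 : {ffun 'I_0 -> 'I_n} := ffun0 (card_ord 0).
  (* The zero vectors are admissible because there are no positions at which a condition is
     imposed. *)
  exists (fun k => if k == ord0 then T a0 else 0), (fun=> 0).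
  split; first by split=> [k []|k k' _ []].
  move=> tau w _; apply: tnorm_le.
  set D := T - _; suff -> : D = 0 by rewrite inner0l inner_ge0.
  rewrite /D big_ord_recl eqxx big1 ?addr0 => [|k _]; last first.
    by rewrite scale0r.
  apply/eqP; rewrite subr_eq0; apply/eqP/ffunP => a; rewrite !ffunE big_ord0.
  have -> : a = a0 by apply/ffunP => -[].
  exact/esym/mulr1.
have [w [aw gmax smax]] := lexicographic_maximizer T (admissible_exists R K d.+1 hr).
have w_const := maximizer_factors_eq hT aw gmax smax.
pose v k := w k ord0.
have vw : w = fun k _ => v k.
  by apply/funext => k; apply/funext => j; exact: w_const.
(* With these coefficients the squared error is exactly |T|^2 minus the maximal gain; any competitor
   has a gain no larger and an additional nonnegative term. *)
exists (fun k => inner T (tensor_pow d.+1 (v k))), v.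
rewrite -vw; split=> // tau w' aw'; apply: tnorm_le.
have W k : tensor_pow d.+1 (v k) = tensor_prod (w k) by rewrite vw.
under eq_bigr do rewrite W.
rewrite (best_coefficients T _ (admissible_orthonormal _ aw)) //.
rewrite (best_coefficients T _ (admissible_orthonormal _ aw')) //.
rewrite [X in _ - _ + X <= _]big1 => [|k _]; last first.
  by rewrite subrr normr0 expr0n.
rewrite addr0 ler_wpDr //; first by apply: sumr_ge0 => k _; rewrite exprn_ge0.
by rewrite lerD2l lerN2; exact: gmax.
Qed.
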